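(* Work in homotopy type theory with a weak Tarski universe, and let $V$ be the type of iterative sets with the type-theoretic interpretation $\llbracket\cdot\rrbracket$ of set-theoretic formulae. The set-theoretic axiom (scheme) of dependent choices is valid in the interpretation. More generally, let $B(x)$ be an extensional family of types over $V$ and let $F(x,y)$ be a family of types over $V\times V$, extensional in each argument, such that $$(\Pi x:V)\bigl(B(x)\to(\Sigma y:V)(B(y)\times F(x,y))\bigr)$$ is inhabited. Then for each $\alpha:V$ such that $B(\alpha)$ is inhabited there is $\delta:V$ such that $\delta$ is a function with domain $\omega$, $\langle\emptyset,\alpha\rangle\in\delta$, and for every $x\in\omega$ and all $\beta,\gamma:V$, $$\bigl(\llbracket\langle x,\beta\rangle\in\delta\rrbracket\times\llbracket\langle S(x),\gamma\rangle\in\delta\rrbracket\bigr)\to\bigl(B(\beta)\times F(\beta,\gamma)\bigr),$$ where $S(x)$ is the successor of $x$.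
   Context: Ambient theory. Homotopy type theory with a weak Tarski universe: intensional Martin-Löf type theory with dependent products $\Pi$ (with definitional $\beta$ and $\eta$), dependent sums $\Sigma$ (projections $\mathsf p,\mathsf q$), identity types $Id$, binary sums $+$ (injections $\mathsf i,\mathsf j$), finite types $\mathbf N_k$, natural numbers $\mathbf N$, $W$-types, and function extensionality (for $f,g:(\Pi x:A)B(x)$ the canonical map $Id(f,g)\to(\Pi x:A)Id(f(x),g(x))$ is an equivalence). $\mathit{Equiv}(A,B)$ is the type of maps $f:A\to B$ with a left inverse and a right inverse up to pointwise identity. The weak Tarski universe is a type $U$ of names with a family $El(a)$ ($a:U$), closed under names for all type constructors: $\pi(a,b),\sigma(a,b),w(a,b):U$ for $a:U$, $b(x):U$ ($x:El(a)$); $i_a(b,c):U$ for $b,c:El(a)$; $plus(a,b):U$; $n:U$; $n_k:U$. Instead of definitional equalities there are only given equivalences: $El(\pi(a,b))\simeq(\Pi x:El(a))El(b(x))$, $El(\sigma(a,b))\simeq(\Sigma x:El(a))El(b(x))$, $El(w(a,b))\simeq(Wx:El(a))El(b(x))$, $El(i_a(b,c))\simeq Id_{El(a)}(b,c)$, $El(plus(a,b))\simeq El(a)+El(b)$, $El(n)\simeq\mathbf N$, $El(n_k)\simeq\mathbf N_k$. (Homotopy type theory also includes univalence: the canonical map $Id_U(a,b)\to\mathit{Equiv}(El(a),El(b))$ is an equivalence.) Iterative sets. $V:=(Wx:U)El(x)$, with canonical elements $\mathsf{sup}(a,f)$, $a:U$, $f:El(a)\to V$. For $\alpha:V$ there are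 $\overline\alpha:U$ and $\tilde\alpha:El(\overline\alpha)\to V$, defined by recursion, with $\overline{\mathsf{sup}(a,f)}=a$ and $\widetilde{\mathsf{sup}(a,f)}=f$. Extensional equality $\alpha\doteq\beta$ is the type defined by double transfinite recursion on $V$ by $(\mathsf{sup}(a,f)\doteq\mathsf{sup}(b,g)):=(\Pi x:El(a))(\Sigma y:El(b))(f(x)\doteq g(y))\times(\Pi y:El(b))(\Sigma x:El(a))(f(x)\doteq g(y))$. Language and interpretation. The language of CZF is first order, with logical symbols $\bot,\wedge,\vee,\Rightarrow,\forall x,\exists x$, primitive restricted quantifiers $\forall x\in y$, $\exists x\in y$, and relation symbols $\in$ and equality (written $\doteq$). $\mathcal L_V$ adds a constant for each $\alpha:V$. The interpretation is: $\llbracket\alpha\doteq\beta\rrbracket=(\alpha\doteq\beta)$; $\llbracket\alpha\in\beta\rrbracket=(\Sigma y:El(\overline\beta))(\alpha\doteq\tilde\beta(y))$; $\llbracket\bot\rrbracket=\mathbf N_0$; $\Rightarrow,\wedge,\vee$ are interpreted by $\to,\times,+$; $\llbracket(\forall x\in\alpha)\phi(x)\rrbracket=(\Pi x:El(\overline\alpha))\llbracket\phi(\tilde\alpha(x))\rrbracket$; $\llbracket(\exists x\in\alpha)\phi(x)\rrbracket=(\Sigma x:El(\overline\alpha))\llbracket\phi(\tilde\alpha(x))\rrbracket$; $\llbracket\forall x\,\phi(x)\rrbracket=(\Pi\alpha:V)\llbracket\phi(\alpha)\rrbracket$; $\llbracket\exists x\,\phi(x)\rrbracket=(\Sigma\alpha:V)\llbracket\phi(\alpha)\rrbracket$.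 A formula is valid iff the interpretation of its universal closure is inhabited; set-theoretic assertions about elements of $V$ (such as $\langle\emptyset,\alpha\rangle\in\delta$) mean that their interpretation is inhabited. A family $B(x)$ over $V$ is extensional iff $(\Pi x,y:V)((x\doteq y)\times B(x)\to B(y))$ is inhabited. Sets in $V$. Pairs: $\{\alpha,\beta\}:=\mathsf{sup}(n_2,g'\circ\tau)$ with $\tau:El(n_2)\to\mathbf N_2$ the given equivalence and $g':\mathbf N_2\to V$ taking the values $\alpha,\beta$; ordered pairs $\langle\alpha,\beta\rangle:=\{\{\alpha,\alpha\},\{\alpha,\beta\}\}$. $\emptyset:=\mathsf{sup}(n_0,f_0)$ with $f_0:El(n_0)\to\mathbf N_0\to V$. Successor: $S(\alpha):=\mathsf{sup}(plus(\overline\alpha,n_1),h'(\alpha)\circ\tau)$, with $\tau:El(plus(\overline\alpha,n_1))\to El(\overline\alpha)+\mathbf N_1$ the equivalence obtained from the given ones, $h'(\alpha)(\mathsf i(x))=\tilde\alpha(x)$, and $h'(\alpha)(\mathsf j( * ))=\alpha$ for the element $*$ of $\mathbf N_1$. $\omega:=\mathsf{sup}(n,\Delta'\circ\tau)$ with $\tau:El(n)\to\mathbf N$ the given equivalence, $\Delta'(0)=\emptyset$, $\Delta'(s(m))=S(\Delta'(m))$. A set is a relation iff all its elements are ($\doteq$ to) ordered pairs; it has domain $\alpha$ iff $\forall x(x\in\alpha\Leftrightarrow\exists y\,\langle x,y\rangle\in\gamma)$; a function is a single-valued (up to $\doteq$) relation. Dependent choices scheme: for formulae $\theta(x)$, $\phi(x,y)$,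 $\forall x(\theta(x)\Rightarrow\exists y(\theta(y)\wedge\phi(x,y)))\Rightarrow\forall x(\theta(x)\Rightarrow\exists z\,\psi(x,z))$, where $\psi(x,z)$ says that $z$ is a function with domain $\omega$ such that $z(0)\doteq x$ and, for every $m\in\omega$, $\theta(z(m))\wedge\phi(z(m),z(m+1))$. *)

(* Defs.v *)
From Stdlib Require Fin.
From Stdlib Require Export Well_Ordering.

Set Implicit Arguments.
Unset Strict Implicit.

(** Everything is kept in [Type] (propositions as types).  Dependent products
    are [forall], dependent sums [sigT], binary sums [sum], [N] is [nat], the
    finite type [N_k] is [Fin.t k] and [(W x : A) B x] is [WO A B]. *)

Inductive Id {A : Type} (a : A) : A -> Type :=
| refl : Id a a.

Arguments refl {A a}.

Definition isequiv {A B : Type} (f : A -> B) : Type :=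
  {g : B -> A & forall x, Id (g (f x)) x} *
  {h : B -> A & forall y, Id (f (h y)) y}.

Definition Equiv (A B : Type) : Type := {f : A -> B & isequiv f}.

Definition equiv_map {A B : Type} (e : Equiv A B) : A -> B := projT1 e.
Coercion equiv_map : Equiv >-> Funclass.

Definition idequiv (A : Type) : Equiv A A :=
  existT _ (fun x => x)
    (existT _ (fun x => x) (fun _ => refl),
     existT _ (fun x => x) (fun _ => refl)).

Definition happly {A : Type} {B : A -> Type} (f g : forall x : A, B x)
    (p : Id f g) : forall x, Id (f x) (g x) :=
  match p in Id _ g' return forall x, Id (f x) (g' x) with
  | refl => fun _ => refl
  end.

Definition FunExt : Type :=
  forall (A : Type) (B : A -> Type) (f g : forall x : A, B x),
    isequiv (@happly A B f g).

Record weak_tarski : Type := {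
  U : Type;
  El : U -> Type;
  c_pi : forall a : U, (El a -> U) -> U;
  c_sigma : forall a : U, (El a -> U) -> U;
  c_w : forall a : U, (El a -> U) -> U;
  c_id : forall a : U, El a -> El a -> U;
  c_plus : U -> U -> U;
  c_nat : U;
  c_fin : nat -> U;
  El_pi : forall a b, Equiv (El (@c_pi a b)) (forall x : El a, El (b x));
  El_sigma : forall a b, Equiv (El (@c_sigma a b)) {x : El a & El (b x)};
  El_w : forall a b, Equiv (El (@c_w a b)) (WO (El a) (fun x => El (b x)));
  El_id : forall a (b c : El a), Equiv (El (@c_id a b c)) (Id b c);
  El_plus : forall a b, Equiv (El (c_plus a b)) (El a + El b);
  El_nat : Equiv (El c_nat) nat;
  El_fin : forall k, Equiv (El (c_fin k)) (Fin.t k)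
}.

Arguments El {_} _.
Arguments c_plus {_} _ _.
Arguments c_nat {_}.
Arguments c_fin {_} _.
Arguments El_plus {_} _ _.
Arguments El_nat {_}.
Arguments El_fin {_} _.

Definition idtoequiv {T : weak_tarski} (a b : U T) (p : Id a b) :
    Equiv (El a) (El b) :=
  match p in Id _ b' return Equiv (El a) (El b') with
  | refl => idequiv (El a)
  end.

Definition univalent (T : weak_tarski) : Type :=
  forall a b : U T, isequiv (@idtoequiv T a b).

Definition V (T : weak_tarski) : Type := WO (U T) El.

Definition supV {T : weak_tarski} (a : U T) (f : El a -> V T) : V T :=
  sup (U T) El a f.

Definition bar {T : weak_tarski} (α : V T) : U T :=
  match α with sup _ _ a _ => a end.

Definition tilde {T : weak_tarski} (α : V T) : El (bar α) -> V T :=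
  match α return El (bar α) -> V T with sup _ _ _ f => f end.

Arguments tilde {T} α x.

Fixpoint eqV {T : weak_tarski} (α β : V T) {struct α} : Type :=
  match α, β with
  | sup _ _ a f, sup _ _ b g =>
      (forall x : El a, {y : El b & eqV (f x) (g y)}) *
      (forall y : El b, {x : El a & eqV (f x) (g y)})
  end.

Definition memV {T : weak_tarski} (α β : V T) : Type :=
  {y : El (bar β) & eqV α (tilde β y)}.

Definition extensional {T : weak_tarski} (B : V T -> Type) : Type :=
  forall x y : V T, eqV x y * B x -> B y.

Definition fcons {A : Type} {k : nat} (a : A) (e : Fin.t k -> A)
    (j : Fin.t (S k)) : A :=
  Fin.caseS' j (fun _ => A) a e.

Definition pairV {T : weak_tarski} (α β : V T) : V T :=
  supV (fun u : El (c_fin 2) =>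
          fcons (k := 1) α (fun _ => β) (El_fin 2 u)).

Definition opairV {T : weak_tarski} (α β : V T) : V T :=
  pairV (pairV α α) (pairV α β).

Definition emptyV (T : weak_tarski) : V T :=
  supV (fun u : El (c_fin 0) => Fin.case0 (fun _ => V T) (El_fin 0 u)).

Definition succ_index {T : weak_tarski} (a : U T)
    (u : El (c_plus a (c_fin 1))) : El a + Fin.t 1 :=
  match El_plus a (c_fin 1) u with
  | inl x => inl x
  | inr y => inr (El_fin 1 y)
  end.

Definition succV {T : weak_tarski} (α : V T) : V T :=
  supV (fun u : El (c_plus (bar α) (c_fin 1)) =>
          match succ_index u with
          | inl x => tilde α x
          | inr _ => α
          end).

Fixpoint numeralV (T : weak_tarski) (m : nat) : V T :=
  match m with
  | O => emptyV T
  | S m' => succV (numeralV T m')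
  end.

Definition omegaV (T : weak_tarski) : V T :=
  supV (fun u : El c_nat => numeralV T (El_nat u)).

Definition is_relation {T : weak_tarski} (γ : V T) : Type :=
  forall p : V T, memV p γ -> {x : V T & {y : V T & eqV p (opairV x y)}}.

Definition single_valued {T : weak_tarski} (γ : V T) : Type :=
  forall x y y' : V T,
    memV (opairV x y) γ -> memV (opairV x y') γ -> eqV y y'.

Definition is_function {T : weak_tarski} (γ : V T) : Type :=
  is_relation γ * single_valued γ.

Definition has_domain {T : weak_tarski} (γ α : V T) : Type :=
  forall x : V T,
    (memV x α -> {y : V T & memV (opairV x y) γ}) *
    ({y : V T & memV (opairV x y) γ} -> memV x α).

(** The language L_V in de Bruijn syntax: [formula T k] is the type of
    formulae whose free variables are among the [k] variables indexed by
    [Fin.t k], the index [Fin.F1] denoting the variable bound last.  The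
    formulae of CZF are those in which [cst] does not occur. *)

Inductive term (T : weak_tarski) (k : nat) : Type :=
| var : Fin.t k -> term T k
| cst : V T -> term T k.

Arguments var {T k} _.
Arguments cst {T k} _.

Inductive formula (T : weak_tarski) (k : nat) : Type :=
| feq : term T k -> term T k -> formula T k
| fin : term T k -> term T k -> formula T k
| fbot : formula T k
| fand : formula T k -> formula T k -> formula T k
| for_ : formula T k -> formula T k -> formula T k
| fimp : formula T k -> formula T k -> formula T k
| fall_in : term T k -> formula T (S k) -> formula T k
| fex_in : term T k -> formula T (S k) -> formula T k
| fall : formula T (S k) -> formula T k
| fex : formula T (S k) -> formula T k.

Arguments fbot {T k}.

Definition eval {T : weak_tarski} {k : nat} (e : Fin.t k -> V T)
    (t : term T k) : V T :=
  match t with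
  | var j => e j
  | cst α => α
  end.

Fixpoint interp {T : weak_tarski} {k : nat} (φ : formula T k) :
    (Fin.t k -> V T) -> Type :=
  match φ with
  | feq s t => fun e => eqV (eval e s) (eval e t)
  | fin s t => fun e => memV (eval e s) (eval e t)
  | fbot => fun _ => Fin.t 0
  | fand φ1 φ2 => fun e => (interp φ1 e * interp φ2 e)%type
  | for_ φ1 φ2 => fun e => (interp φ1 e + interp φ2 e)%type
  | fimp φ1 φ2 => fun e => interp φ1 e -> interp φ2 e
  | fall_in t φ1 => fun e =>
      forall x : El (bar (eval e t)), interp φ1 (fcons (tilde (eval e t) x) e)
  | fex_in t φ1 => fun e =>
      {x : El (bar (eval e t)) & interp φ1 (fcons (tilde (eval e t) x) e)}
  | fall φ1 => fun e => forall α : V T, interp φ1 (fcons α e)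
  | fex φ1 => fun e => {α : V T & interp φ1 (fcons α e)}
  end.

Fixpoint universal_closure {T : weak_tarski} {k : nat} :
    formula T k -> formula T 0 :=
  match k with
  | O => fun φ => φ
  | S k' => fun φ => universal_closure (fall φ)
  end.

Definition valid {T : weak_tarski} {k : nat} (φ : formula T k) : Type :=
  interp (universal_closure φ) (Fin.case0 (fun _ => V T)).

Definition ren_term {T : weak_tarski} {k l : nat} (r : Fin.t k -> Fin.t l)
    (t : term T k) : term T l :=
  match t with
  | var j => var (r j)
  | cst α => cst α
  end.

Definition ren_up {k l : nat} (r : Fin.t k -> Fin.t l) :
    Fin.t (S k) -> Fin.t (S l) :=
  fcons Fin.F1 (fun j => Fin.FS (r j)).

Fixpoint ren {T : weak_tarski} {k l : nat} (r : Fin.t k -> Fin.t l)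
    (φ : formula T k) : formula T l :=
  match φ with
  | feq s t => feq (ren_term r s) (ren_term r t)
  | fin s t => fin (ren_term r s) (ren_term r t)
  | fbot => fbot
  | fand φ1 φ2 => fand (ren r φ1) (ren r φ2)
  | for_ φ1 φ2 => for_ (ren r φ1) (ren r φ2)
  | fimp φ1 φ2 => fimp (ren r φ1) (ren r φ2)
  | fall_in t φ1 => fall_in (ren_term r t) (ren (ren_up r) φ1)
  | fex_in t φ1 => fex_in (ren_term r t) (ren (ren_up r) φ1)
  | fall φ1 => fall (ren (ren_up r) φ1)
  | fex φ1 => fex (ren (ren_up r) φ1)
  end.

(** A formula [θ(x)] with [k] parameters is an element of [formula T (1 + k)],
    [x] having index 0; a formula [φ(x, y)] is an element of
    [formula T (2 + k)], [x] having index 1 and [y] index 0.  [inst1 l θ u] is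
    [θ(u)] and [inst2 l φ u v] is [φ(u, v)], both weakened to a context in
    which [l] further variables are bound inside the scope of the
    parameters. *)

Definition inst1 {T : weak_tarski} {k : nat} (l : nat)
    (θ : formula T (1 + k)) (u : Fin.t (l + k)) : formula T (l + k) :=
  ren (fcons u (Fin.R l)) θ.

Arguments inst1 {T k} l θ u.

Definition inst2 {T : weak_tarski} {k : nat} (l : nat)
    (φ : formula T (2 + k)) (u v : Fin.t (l + k)) : formula T (l + k) :=
  ren (fcons v (fcons u (Fin.R l))) φ.

Arguments inst2 {T k} l φ u v.

Declare Scope czf_scope.
Delimit Scope czf_scope with czf.
Bind Scope czf_scope with formula.

Notation "s ≐ t" := (feq s t) (at level 70, no associativity) : czf_scope.
Notation "s ∈ t" := (fin s t) (at level 70, no associativity) : czf_scope.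
Notation "φ ∧ ψ" := (fand φ ψ) (at level 80, right associativity) : czf_scope.
Notation "φ ∨ ψ" := (for_ φ ψ) (at level 85, right associativity) : czf_scope.
Notation "φ ⇒ ψ" := (fimp φ ψ) (at level 95, right associativity) : czf_scope.
Notation "↑ t" := (ren_term Fin.FS t) (at level 9, t at level 9).

Definition i0 {k : nat} : Fin.t (1 + k) := Fin.F1.
Definition i1 {k : nat} : Fin.t (2 + k) := Fin.FS i0.
Definition i2 {k : nat} : Fin.t (3 + k) := Fin.FS i1.
Definition i3 {k : nat} : Fin.t (4 + k) := Fin.FS i2.
Definition i4 {k : nat} : Fin.t (5 + k) := Fin.FS i3.
Definition i5 {k : nat} : Fin.t (6 + k) := Fin.FS i4.

Open Scope czf_scope.

Definition fiff {T : weak_tarski} {k : nat} (φ ψ : formula T k) :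
    formula T k :=
  (φ ⇒ ψ) ∧ (ψ ⇒ φ).

Definition f_empty {T : weak_tarski} {k : nat} (t : term T k) : formula T k :=
  fall_in t fbot.

(** [t = {a, b}] *)
Definition f_pair {T : weak_tarski} {k : nat} (t a b : term T k) :
    formula T k :=
  a ∈ t ∧ b ∈ t ∧ fall_in t (var i0 ≐ ↑ a ∨ var i0 ≐ ↑ b).

(** [t = ⟨a, b⟩], that is [t = {u, v}] with [u = {a, a}] and [v = {a, b}] *)
Definition f_opair {T : weak_tarski} {k : nat} (t a b : term T k) :
    formula T k :=
  fex (fex (f_pair (var i1) (↑ ↑ a) (↑ ↑ a) ∧
            f_pair (var i0) (↑ ↑ a) (↑ ↑ b) ∧
            f_pair (↑ ↑ t) (var i1) (var i0))).

(** [⟨a, b⟩ ∈ t] *)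
Definition f_opair_in {T : weak_tarski} {k : nat} (a b t : term T k) :
    formula T k :=
  fex_in t (f_opair (var i0) (↑ a) (↑ b)).

(** [t = a ∪ {a}] *)
Definition f_succ {T : weak_tarski} {k : nat} (t a : term T k) :
    formula T k :=
  fall_in a (var i0 ∈ ↑ t) ∧ a ∈ t ∧
  fall_in t (var i0 ∈ ↑ a ∨ var i0 ≐ ↑ a).

Definition f_inductive {T : weak_tarski} {k : nat} (t : term T k) :
    formula T k :=
  fex_in t (f_empty (var i0)) ∧
  fall_in t (fex_in (↑ t) (f_succ (var i0) (var i1))).

(** [t = ω]: [t] is the least inductive set *)
Definition f_omega {T : weak_tarski} {k : nat} (t : term T k) : formula T k :=
  f_inductive t ∧
  fall (f_inductive (var i0) ⇒ fall_in (↑ t) (var i0 ∈ var i1)).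

Definition f_relation {T : weak_tarski} {k : nat} (t : term T k) :
    formula T k :=
  fall_in t (fex (fex (f_opair (var i2) (var i1) (var i0)))).

Definition f_function {T : weak_tarski} {k : nat} (t : term T k) :
    formula T k :=
  f_relation t ∧
  fall (fall (fall
    (f_opair_in (var i2) (var i1) (↑ ↑ ↑ t) ∧
     f_opair_in (var i2) (var i0) (↑ ↑ ↑ t) ⇒
     var i1 ≐ var i0))).

Definition f_domain {T : weak_tarski} {k : nat} (t d : term T k) :
    formula T k :=
  fall (fiff (var i0 ∈ ↑ d)
             (fex (f_opair_in (var i1) (var i0) (↑ ↑ t)))).

(** [ψ(x, z)], with [x] of index 1 and [z] of index 0.  Below [fex], [ω] has
    index 0, [z] index 1 and [x] index 2.  In the last conjunct [v], [u], [m'],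
    [m], [ω], [z] have the indices 0, ..., 5, and it reads: for all [m ∈ ω] and
    all [m'], [u], [v] with [m' = m + 1], [⟨m, u⟩ ∈ z] and [⟨m', v⟩ ∈ z], one
    has [θ(u)] and [φ(u, v)]. *)
Definition DC_psi {T : weak_tarski} {k : nat}
    (θ : formula T (1 + k)) (φ : formula T (2 + k)) : formula T (2 + k) :=
  fex
    (f_omega (var i0) ∧
     f_function (var i1) ∧
     f_domain (var i1) (var i0) ∧
     fex (f_empty (var i0) ∧ f_opair_in (var i0) (var i3) (var i2)) ∧
     fall_in (var i0)
       (fall (fall (fall
          (f_succ (var i2) (var i3) ∧
           f_opair_in (var i3) (var i1) (var i5) ∧
           f_opair_in (var i2) (var i0) (var i5) ⇒
           inst1 7 θ i1 ∧ inst2 7 φ i1 i0))))).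

Definition DC {T : weak_tarski} {k : nat}
    (θ : formula T (1 + k)) (φ : formula T (2 + k)) : formula T k :=
  fall (inst1 1 θ i0 ⇒ fex (inst1 2 θ i0 ∧ inst2 2 φ i1 i0)) ⇒
  fall (inst1 1 θ i0 ⇒ fex (DC_psi θ φ)).

Close Scope czf_scope.

(* Main.v *)
(** Iterating the given step map on [{x : V & B x}], which requires no choice
    because sums are strong, yields a sequence [s : nat -> V] with [s 0 = α],
    and [δ] is its graph [{⟨Δ(m), s(m)⟩ | m : N}] over the numerals [Δ(m)].
    The graph is single-valued because [Δ(m) ≐ Δ(n)] implies [m = n], by
    irreflexivity of membership; extensionality of [B] and [F] then transfers
    the properties of [s] to all sets [≐] to its values.  The axiom scheme is
    the case in which [B] and [F] are interpretations of formulae, which are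
    extensional. *)
Require Import Defs.
From Stdlib Require Import CRelationClasses Compare_dec PeanoNat.

(** The right inverse read as a split surjection: it supplies preimages in the decoding of a name,
    where the universe has no definitional equalities. *)
Definition equiv_section {A B : Type} (e : Equiv A B) (y : B) :
    {x : A & Id (e x) y} :=
  let (h, H) := snd (projT2 e) in existT _ (h y) (H y).

Section Iterative_sets.

Context {T : weak_tarski}.
Implicit Types α β γ δ x y z : V T.

(** * Extensional equality and membership *)

Lemma eqV_refl α : eqV α α.
Proof.
induction α as [a f IH]; cbn; split; intro x; exists x; apply IH.
Qed.

Lemma eqV_sym α β : eqV α β -> eqV β α.
Proof.
revert β; induction α as [a f IH]; intros [b g] [H K]; split.
- intro y; destruct (K y) as [x E]; exists x; exact (IH _ _ E).
- intro x; destruct (H x) as [y E]; exists y; exact (IH _ _ E).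
Qed.

Lemma eqV_trans α β γ : eqV α β -> eqV β γ -> eqV α γ.
Proof.
revert β γ; induction α as [a f IH]; intros [b g] [c h] [H K] [H' K']; split.
- intro x; destruct (H x) as [y E]; destruct (H' y) as [z E'].
  exists z; exact (IH _ _ _ E E').
- intro z; destruct (K' z) as [y E']; destruct (K y) as [x E].
  exists x; exact (IH _ _ _ E E').
Qed.

#[local] Instance eqV_equivalence : Equivalence (@eqV T) :=
  Build_Equivalence _ eqV_refl eqV_sym eqV_trans.

(** [eqV] unfolds only on two constructors; this and its mirror image make its two halves usable on
    arbitrary sets. *)
Lemma eqV_tilde_l α β : eqV α β ->
  forall x : El (bar α), {y : El (bar β) & eqV (tilde α x) (tilde β y)}.
Proof. destruct α, β; intros [H _]; exact H. Qed.

Lemma eqV_tilde_r α β : eqV α β ->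
  forall y : El (bar β), {x : El (bar α) & eqV (tilde α x) (tilde β y)}.
Proof. destruct α, β; intros [_ H]; exact H. Qed.

Lemma memV_tilde α (x : El (bar α)) : memV (tilde α x) α.
Proof. exists x; reflexivity. Qed.

Lemma memV_eqV_l x y α : eqV x y -> memV x α -> memV y α.
Proof. intros E [u H]; exists u; transitivity x; [symmetry|]; assumption. Qed.

Lemma memV_eqV_r x α β : eqV α β -> memV x α -> memV x β.
Proof.
intros E [u H]; destruct (eqV_tilde_l _ _ E u) as [v H'].
exists v; transitivity (tilde α u); assumption.
Qed.

Lemma extensionality α β :
  (forall x, memV x α -> memV x β) -> (forall x, memV x β -> memV x α) ->
  eqV α β.
Proof.
intros H K; destruct α as [a f], β as [b g]; split.
- intro x; exact (H _ (memV_tilde (sup _ _ a f) x)).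
- intro y; destruct (K _ (memV_tilde (sup _ _ b g) y)) as [x E].
  exists x; symmetry; exact E.
Qed.

(** If [α ∈ α], then [α ≐ f u] for some index [u]; since [f u ∈ α], also [f u ∈ f u], which the
    induction hypothesis at [u] excludes. *)
Lemma memV_irrefl α : memV α α -> False.
Proof.
induction α as [a f IH]; intros [u E]; apply (IH u).
apply (memV_eqV_r _ _ _ E); exact (memV_tilde (sup _ _ a f) u).
Qed.

(** * Pairs, successors and numerals *)

(** Pairs, successors, [ω] and graphs are all indexed through a map [q] out of a decoded name. A
    section of [q] lets membership be computed over the concrete index type [I]. *)
Lemma mem_supV_comp {I : Type} {a : U T} (q : El a -> I) (f : I -> V T) x :
  (forall i, {u : El a & Id (q u) i}) ->
  iffT (memV x (supV (fun u => f (q u)))) {i : I & eqV x (f i)}.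
Proof.
intro surj; split.
- intros [u E]; exists (q u); exact E.
- intros [i E]; destruct (surj i) as [u H].
  exists u; cbn; destruct H; exact E.
Qed.

Lemma mem_pairV x α β : iffT (memV x (pairV α β)) (eqV x α + eqV x β).
Proof.
eapply iffT_Transitive;
  [exact (mem_supV_comp _ _ _ (equiv_section (El_fin 2)))|split].
- intros [i E]; revert E; apply (Fin.caseS' i); [now left|].
  intros j E; right; exact E.
- intros [E|E]; [exists Fin.F1|exists (Fin.FS Fin.F1)]; exact E.
Qed.

Lemma mem_emptyV x : memV x (emptyV T) -> False.
Proof. intros [u _]; exact (Fin.case0 (fun _ => False) (El_fin 0 u)). Qed.

Lemma succ_index_section (a : U T) (i : El a + Fin.t 1) :
  {u : El (c_plus a (c_fin 1)) & Id (succ_index u) i}.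
Proof.
unfold succ_index; destruct i as [x|j].
- destruct (equiv_section (El_plus a (c_fin 1)) (inl x)) as [u H].
  (* Destructing the value of the equivalence at [u] makes the [match] of [succ_index] reduce;
     [inversion] discards the wrong injection. *)
  exists u; revert H; destruct (equiv_map _ u); intro H; inversion H; exact refl.
- destruct (equiv_section (El_fin (w := T) 1) j) as [v K].
  destruct (equiv_section (El_plus a (c_fin 1)) (inr v)) as [u H].
  exists u; revert H; destruct (equiv_map _ u); intro H; inversion H; subst.
  destruct K; exact refl.
Qed.

Lemma mem_succV x α : iffT (memV x (succV α)) (memV x α + eqV x α).
Proof.
eapply iffT_Transitive.
- exact (mem_supV_comp (@succ_index T (bar α))
    (fun i => match i with inl v => tilde α v | inr _ => α end) x
    (succ_index_section (bar α))).
- split.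
  + intros [[v|v] E]; [left; exists v|right]; exact E.
  + intros [[v E]|E]; [exists (inl v)|exists (inr Fin.F1)]; exact E.
Qed.

Lemma mem_omegaV x :
  iffT (memV x (omegaV T)) {m : nat & eqV x (numeralV T m)}.
Proof. exact (mem_supV_comp _ _ _ (equiv_section El_nat)). Qed.

Lemma pairV_eqV α α' β β' :
  eqV α α' -> eqV β β' -> eqV (pairV α β) (pairV α' β').
Proof.
intros E E'; apply extensionality; intros x H; apply mem_pairV;
  apply mem_pairV in H; destruct H as [H|H]; [left|right|left|right];
  (etransitivity; [exact H|]); first [assumption|symmetry; assumption].
Qed.

Lemma opairV_eqV α α' β β' :
  eqV α α' -> eqV β β' -> eqV (opairV α β) (opairV α' β').
Proof. intros; apply pairV_eqV; apply pairV_eqV; assumption. Qed.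

(** Each component is a member of its own pair, hence of the other one. *)
Lemma pairV_inv α β γ δ : eqV (pairV α β) (pairV γ δ) ->
  (eqV α γ + eqV α δ) * (eqV β γ + eqV β δ) *
  (eqV γ α + eqV γ β) * (eqV δ α + eqV δ β).
Proof.
intro E; repeat split; apply mem_pairV;
  first [apply (memV_eqV_r _ _ _ E)|apply (memV_eqV_r _ _ _ (eqV_sym _ _ E))];
  apply mem_pairV; first [left; reflexivity|right; reflexivity].
Qed.

(** A constructive argument for Kuratowski pairs, with no case distinction on [α ≐ β]. After
    [α ≐ γ], one has [β ≐ γ] or [β ≐ δ], and [δ ≐ α] or [δ ≐ β]; in the one case left over, [β ≐ γ]
    and [δ ≐ α], all four sets coincide. *)
Lemma opairV_inj α β γ δ :
  eqV (opairV α β) (opairV γ δ) -> eqV α γ * eqV β δ.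
Proof.
intro E; destruct (pairV_inv _ _ _ _ E) as [[[H1 H2] _] H4].
assert (Eα : eqV α γ).
{ destruct H1 as [H|H]; destruct (pairV_inv _ _ _ _ H) as [[[[K|K] _] [L|L]] _];
    first [exact K|symmetry; exact L]. }
split; [exact Eα|].
assert (Eβ : eqV β γ + eqV β δ).
{ destruct H2 as [H|H]; destruct (pairV_inv _ _ _ _ H) as [[[_ [K|K]] _] _];
    auto. }
assert (Eδ : eqV δ α + eqV δ β).
{ destruct H4 as [H|H]; destruct (pairV_inv _ _ _ _ H) as [[[_ [K|K]] _] _];
    auto. }
destruct Eβ as [Eβ|Eβ]; [|exact Eβ].
destruct Eδ as [Eδ|Eδ]; [|symmetry; exact Eδ].
transitivity γ; [exact Eβ|transitivity α; symmetry; assumption].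
Qed.

Lemma succV_eqV α β : eqV α β -> eqV (succV α) (succV β).
Proof.
intro E; apply extensionality; intros x H; apply mem_succV;
  apply mem_succV in H; destruct H as [H|H].
- left; exact (memV_eqV_r _ _ _ E H).
- right; transitivity α; assumption.
- left; exact (memV_eqV_r _ _ _ (eqV_sym _ _ E) H).
- right; transitivity β; [|symmetry]; assumption.
Qed.

Lemma mem_numeralV_lt m n : m < n -> memV (numeralV T m) (numeralV T n).
Proof.
induction n as [|n IH]; intro H; [exfalso; exact (Nat.nlt_0_r _ H)|].
apply mem_succV; destruct (le_lt_eq_dec m n) as [L|L].
- apply Nat.lt_succ_r; exact H.
- left; exact (IH L).
- right; destruct L; reflexivity.
Qed.

(** Trichotomy on [nat] is decidable, and either strict inequality would make a numeral a member of
    itself. *)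
Lemma numeralV_inj m n : eqV (numeralV T m) (numeralV T n) -> m = n.
Proof.
intro E; destruct (lt_eq_lt_dec m n) as [[H|H]|H]; [exfalso|exact H|exfalso].
- apply (memV_irrefl (numeralV T n)).
  exact (memV_eqV_l _ _ _ E (mem_numeralV_lt _ _ H)).
- apply (memV_irrefl (numeralV T n)).
  exact (memV_eqV_r _ _ _ E (mem_numeralV_lt _ _ H)).
Qed.

(** * Graphs of sequences *)

Definition graphV (s : nat -> V T) : V T :=
  supV (fun u : El c_nat => opairV (numeralV T (El_nat u)) (s (El_nat u))).

Lemma mem_graphV (s : nat -> V T) p :
  iffT (memV p (graphV s)) {m : nat & eqV p (opairV (numeralV T m) (s m))}.
Proof.
exact (mem_supV_comp _ (fun m => opairV (numeralV T m) (s m)) _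
         (equiv_section El_nat)).
Qed.

Lemma opair_mem_graphV (s : nat -> V T) x y :
  iffT (memV (opairV x y) (graphV s))
       {m : nat & (eqV x (numeralV T m) * eqV y (s m))%type}.
Proof.
eapply iffT_Transitive; [apply mem_graphV|split]; intros [m E]; exists m.
- exact (opairV_inj _ _ _ _ E).
- apply opairV_eqV; apply E.
Qed.

Lemma graphV_function (s : nat -> V T) : is_function (graphV s).
Proof.
split.
- intros p H; apply mem_graphV in H; destruct H as [m E].
  exists (numeralV T m), (s m); exact E.
- intros x y y' H H'; apply opair_mem_graphV in H, H'.
  destruct H as [m [Em Ey]], H' as [n [En Ey']].
  assert (mn : m = n).
  { apply numeralV_inj; transitivity x; [symmetry|]; assumption. }
  destruct mn; transitivity (s m); [|symmetry]; assumption.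
Qed.

Lemma graphV_domain (s : nat -> V T) : has_domain (graphV s) (omegaV T).
Proof.
intro x; split.
- intro H; apply mem_omegaV in H; destruct H as [m E].
  exists (s m); apply opair_mem_graphV; exists m; split; [exact E|reflexivity].
- intros [y H]; apply opair_mem_graphV in H; destruct H as [m [E _]].
  apply mem_omegaV; exists m; exact E.
Qed.

(** * Dependent choice for extensional families *)

Theorem dependent_choice (B : V T -> Type) (F : V T -> V T -> Type) :
  extensional B ->
  (forall y, extensional (fun x => F x y)) ->
  (forall x, extensional (fun y => F x y)) ->
  (forall x, B x -> {y : V T & (B y * F x y)%type}) ->
  forall α, B α ->
  {δ : V T &
    (is_function δ *
     has_domain δ (omegaV T) *
     memV (opairV (emptyV T) α) δ *
     (forall x, memV x (omegaV T) ->
      forall β γ,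
        memV (opairV x β) δ * memV (opairV (succV x) γ) δ ->
        B β * F β γ))%type}.
Proof.
intros extB extFl extFr step α Bα.
(* The proof of [B] travels along the chain, since each choice may depend on it. *)
pose (next (p : {x : V T & B x}) := step (projT1 p) (projT2 p)).
pose (chain := nat_rect (fun _ => {x : V T & B x}) (existT _ α Bα)
  (fun _ p => existT _ (projT1 (next p)) (fst (projT2 (next p))))).
pose (s m := projT1 (chain m)).
(* [s (S m)] is by computation the set chosen by [next (chain m)]. *)
assert (sF : forall m, F (s m) (s (S m))).
{ intro m; exact (snd (projT2 (next (chain m)))). }
exists (graphV s); split; [split; [split|]|].
- apply graphV_function.
- apply graphV_domain.
- apply opair_mem_graphV; exists 0; split; reflexivity.
- intros x _ β γ [H H']; apply opair_mem_graphV in H, H'.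
  destruct H as [m [Em Eβ]], H' as [n [En Eγ]].
  (* From [x ≐ Δ(m)] and [S(x) ≐ Δ(n)] the numerals of [S m] and [n] agree, so [β] and [γ] are [≐]
     to consecutive values of [s]. *)
  assert (mn : S m = n).
  { apply numeralV_inj; transitivity (succV x); [symmetry|exact En].
    exact (succV_eqV _ _ Em). }
  destruct mn; symmetry in Eβ, Eγ; split.
  + exact (extB _ _ (Eβ, projT2 (chain m))).
  + exact (extFl _ _ _ (Eβ, extFr _ _ _ (Eγ, sF m))).
Qed.

(** * Interpretation of formulae *)

(* Combining renaming with extensionality makes the induction go through
   without function extensionality. *)
Lemma interp_ren {k l : nat} (φ : formula T k) (r : Fin.t k -> Fin.t l)
    (e : Fin.t l -> V T) (e' : Fin.t k -> V T) :
  (forall j, eqV (e (r j)) (e' j)) -> iffT (interp (ren r φ) e) (interp φ e').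
Proof.
revert l r e e'.
assert (Et : forall k l (r : Fin.t k -> Fin.t l) e e' (t : term T k),
  (forall j, eqV (e (r j)) (e' j)) -> eqV (eval e (ren_term r t)) (eval e' t)).
{ intros k' l r e e' [j|α] E; [apply E|reflexivity]. }
(* The bound values are compared only up to [≐]: for restricted quantifiers the two bounds are
   merely [≐], so their elements are matched by [eqV_tilde_l] and [eqV_tilde_r]. *)
assert (Eup : forall k l (r : Fin.t k -> Fin.t l) e e' x x',
  (forall j, eqV (e (r j)) (e' j)) -> eqV x x' ->
  forall j, eqV (fcons x e (ren_up r j)) (fcons x' e' j)).
{ intros k' l r e e' x x' E Ex j; apply (Fin.caseS' j); [exact Ex|exact E]. }
induction φ as [k s t|k s t|k|k φ1 IH1 φ2 IH2|k φ1 IH1 φ2 IH2|k φ1 IH1 φ2 IH2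
  |k t φ IH|k t φ IH|k φ IH|k φ IH]; intros l r e e' E; cbn [ren interp].
- pose proof (Et _ _ _ _ _ s E) as Es; pose proof (Et _ _ _ _ _ t E) as Et'.
  split; intro H.
  + transitivity (eval e (ren_term r s)); [symmetry; exact Es|].
    etransitivity; eassumption.
  + transitivity (eval e' s); [exact Es|].
    transitivity (eval e' t); [exact H|symmetry; exact Et'].
- pose proof (Et _ _ _ _ _ s E) as Es; pose proof (Et _ _ _ _ _ t E) as Et'.
  split; intro H.
  + exact (memV_eqV_l _ _ _ Es (memV_eqV_r _ _ _ Et' H)).
  + exact (memV_eqV_l _ _ _ (eqV_sym _ _ Es)
             (memV_eqV_r _ _ _ (eqV_sym _ _ Et') H)).
- split; exact (fun H => H).
- destruct (IH1 _ _ _ _ E), (IH2 _ _ _ _ E); split; intros []; split; auto.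
- destruct (IH1 _ _ _ _ E), (IH2 _ _ _ _ E); split; intros []; auto.
- destruct (IH1 _ _ _ _ E), (IH2 _ _ _ _ E); split; auto.
- pose proof (Et _ _ _ _ _ t E) as Et'; split; intros H x.
  + destruct (eqV_tilde_r _ _ Et' x) as [y Ey].
    exact (fst (IH _ _ _ _ (Eup _ _ _ _ _ _ _ E Ey)) (H y)).
  + destruct (eqV_tilde_l _ _ Et' x) as [y Ey].
    exact (snd (IH _ _ _ _ (Eup _ _ _ _ _ _ _ E Ey)) (H y)).
- pose proof (Et _ _ _ _ _ t E) as Et'; split; intros [x H].
  + destruct (eqV_tilde_l _ _ Et' x) as [y Ey]; exists y.
    exact (fst (IH _ _ _ _ (Eup _ _ _ _ _ _ _ E Ey)) H).
  + destruct (eqV_tilde_r _ _ Et' x) as [y Ey]; exists y.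
    exact (snd (IH _ _ _ _ (Eup _ _ _ _ _ _ _ E Ey)) H).
- split; intros H α;
    [apply (fst (IH _ _ _ _ (Eup _ _ _ _ _ _ _ E (eqV_refl α))))
    |apply (snd (IH _ _ _ _ (Eup _ _ _ _ _ _ _ E (eqV_refl α))))]; apply H.
- split; intros [α H]; exists α;
    [apply (fst (IH _ _ _ _ (Eup _ _ _ _ _ _ _ E (eqV_refl α))))
    |apply (snd (IH _ _ _ _ (Eup _ _ _ _ _ _ _ E (eqV_refl α))))]; apply H.
Qed.

(** The formula renamed along the identity, evaluated at [e], is equivalent both to [φ] at [e] and
    to [φ] at [e']; so the identity renaming need not be shown to fix [φ]. *)
Lemma interp_eqV {k : nat} (φ : formula T k) (e e' : Fin.t k -> V T) :
  (forall j, eqV (e j) (e' j)) -> interp φ e -> interp φ e'.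
Proof.
intros E H; apply (fst (interp_ren φ (fun j => j) e e' E)).
apply (snd (interp_ren φ (fun j => j) e e (fun j => eqV_refl (e j)))); exact H.
Qed.

Lemma interp_valid {k : nat} (φ : formula T k) :
  (forall e, interp φ e) -> valid φ.
Proof.
intro H; unfold valid; induction k as [|k IH]; [apply H|].
apply IH; intros e α; apply H.
Qed.

(** [Fin.R l] skips the [l] inner variables, so [e'] is constrained only on the parameters. *)
Lemma interp_inst1 {k l : nat} (θ : formula T (1 + k)) (u : Fin.t (l + k))
    (e : Fin.t k -> V T) (e' : Fin.t (l + k) -> V T) :
  (forall j, eqV (e' (Fin.R l j)) (e j)) ->
  iffT (interp (inst1 l θ u) e') (interp θ (fcons (e' u) e)).
Proof.
intro E; apply interp_ren; intro j; apply (Fin.caseS' j); [apply eqV_refl|exact E].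
Qed.

Lemma interp_inst2 {k l : nat} (φ : formula T (2 + k)) (u v : Fin.t (l + k))
    (e : Fin.t k -> V T) (e' : Fin.t (l + k) -> V T) :
  (forall j, eqV (e' (Fin.R l j)) (e j)) ->
  iffT (interp (inst2 l φ u v) e') (interp φ (fcons (e' v) (fcons (e' u) e))).
Proof.
intro E; apply interp_ren; intro j; apply (Fin.caseS' j); [apply eqV_refl|].
intro i; apply (Fin.caseS' i); [apply eqV_refl|exact E].
Qed.

(** * Meaning of the defined set-theoretic formulae *)

Lemma eval_shift {k : nat} (e : Fin.t k -> V T) x (t : term T k) :
  eval (fcons x e) (ren_term Fin.FS t) = eval e t.
Proof. destruct t; reflexivity. Qed.


Lemma interp_empty {k : nat} (e : Fin.t k -> V T) (t : term T k) :
  iffT (interp (f_empty t) e) (eqV (eval e t) (emptyV T)).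
Proof.
split.
- intro H; apply extensionality; intros x Hx; exfalso.
  + destruct Hx as [u _]; exact (Fin.case0 (fun _ => False) (H u)).
  + exact (mem_emptyV _ Hx).
- intros E x; exfalso; apply (mem_emptyV (tilde (eval e t) x)).
  exact (memV_eqV_r _ _ _ E (memV_tilde _ x)).
Qed.

Lemma interp_pair {k : nat} (e : Fin.t k -> V T) (t a b : term T k) :
  iffT (interp (f_pair t a b) e)
       (eqV (eval e t) (pairV (eval e a) (eval e b))).
Proof.
split.
- intros [Ha [Hb H]]; apply extensionality; intros x Hx.
  + destruct Hx as [u E]; apply mem_pairV; specialize (H u); cbn in H.
    rewrite !eval_shift in H.
    destruct H as [H|H]; [left|right]; etransitivity; eassumption.
  + apply mem_pairV in Hx; destruct Hx as [E|E].
    * exact (memV_eqV_l _ _ _ (eqV_sym _ _ E) Ha).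
    * exact (memV_eqV_l _ _ _ (eqV_sym _ _ E) Hb).
- intro E; pose proof (eqV_sym _ _ E) as E'; split; [|split].
  + apply (memV_eqV_r _ _ _ E'), mem_pairV; left; reflexivity.
  + apply (memV_eqV_r _ _ _ E'), mem_pairV; right; reflexivity.
  + intro u; cbn; rewrite !eval_shift; apply mem_pairV.
    exact (memV_eqV_r _ _ _ E (memV_tilde _ u)).
Qed.

Lemma interp_opair {k : nat} (e : Fin.t k -> V T) (t a b : term T k) :
  iffT (interp (f_opair t a b) e)
       (eqV (eval e t) (opairV (eval e a) (eval e b))).
Proof.
split.
- intros [x [y [Hx [Hy Ht]]]]; apply interp_pair in Hx, Hy, Ht.
  rewrite !eval_shift in Hx; rewrite !eval_shift in Hy; rewrite !eval_shift in Ht.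
  etransitivity; [exact Ht|apply pairV_eqV; assumption].
- intro E; exists (pairV (eval e a) (eval e a)), (pairV (eval e a) (eval e b)).
  split; [|split]; apply interp_pair; rewrite !eval_shift;
    [apply eqV_refl|apply eqV_refl|exact E].
Qed.

Lemma interp_opair_in {k : nat} (e : Fin.t k -> V T) (a b t : term T k) :
  iffT (interp (f_opair_in a b t) e)
       (memV (opairV (eval e a) (eval e b)) (eval e t)).
Proof.
split; intros [u H]; exists u.
- apply interp_opair in H; rewrite !eval_shift in H; symmetry; exact H.
- apply interp_opair; rewrite !eval_shift; symmetry; exact H.
Qed.

Lemma interp_succ {k : nat} (e : Fin.t k -> V T) (t a : term T k) :
  iffT (interp (f_succ t a) e) (eqV (eval e t) (succV (eval e a))).
Proof.
split.
- intros [H [Ha K]]; apply extensionality; intros x Hx.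
  + destruct Hx as [u E]; apply mem_succV; specialize (K u); cbn in K.
    rewrite !eval_shift in K; destruct K as [K|K]; [left|right].
    * exact (memV_eqV_l _ _ _ (eqV_sym _ _ E) K).
    * etransitivity; eassumption.
  + apply mem_succV in Hx; destruct Hx as [[u E]|E].
    * specialize (H u); cbn in H; rewrite eval_shift in H.
      exact (memV_eqV_l _ _ _ (eqV_sym _ _ E) H).
    * exact (memV_eqV_l _ _ _ (eqV_sym _ _ E) Ha).
- intro E; pose proof (eqV_sym _ _ E) as E'; split; [|split].
  + intro u; cbn; rewrite eval_shift; apply (memV_eqV_r _ _ _ E'), mem_succV.
    left; apply memV_tilde.
  + apply (memV_eqV_r _ _ _ E'), mem_succV; right; reflexivity.
  + intro u; cbn; rewrite !eval_shift; apply mem_succV.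
    exact (memV_eqV_r _ _ _ E (memV_tilde _ u)).
Qed.

Lemma interp_inductive {k : nat} (e : Fin.t k -> V T) (t : term T k) :
  iffT (interp (f_inductive t) e)
       (memV (emptyV T) (eval e t) *
        (forall x, memV x (eval e t) -> memV (succV x) (eval e t)))%type.
Proof.
split.
- intros [[u H] K]; apply interp_empty in H; split.
  + exists u; symmetry; exact H.
  + intros x [v E]; destruct (K v) as [w Hw]; apply interp_succ in Hw; cbn in Hw.
    (* The type of [w] mentions the shifted bound, so [w] and [Hw] are generalized before
       rewriting. *)
    revert w Hw; rewrite eval_shift; intros w Hw.
    exists w; transitivity (succV (tilde (eval e t) v)); [|symmetry; exact Hw].
    apply succV_eqV; exact E.
- intros [[u H] K]; split.
  + exists u; apply interp_empty; symmetry; exact H.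
  + intro v; destruct (K _ (memV_tilde _ v)) as [w Hw].
    cbn [interp]; rewrite eval_shift.
    exists w; apply interp_succ; symmetry; exact Hw.
Qed.

(** Strict equality allows rewriting inside index types, and suffices because [omegaV] itself will
    be the witness. Leastness is induction on the natural number decoded from an index of [ω]. *)
Lemma interp_omega {k : nat} (e : Fin.t k -> V T) (t : term T k) :
  eval e t = omegaV T -> interp (f_omega t) e.
Proof.
intro Et; split.
- apply interp_inductive; rewrite Et; split.
  + apply mem_omegaV; exists 0; reflexivity.
  + intros x H; apply mem_omegaV in H; destruct H as [m E].
    apply mem_omegaV; exists (S m); apply succV_eqV; exact E.
- intros γ H; apply interp_inductive in H; destruct H as [H0 HS].
  cbn [interp]; rewrite eval_shift, Et; intro u; cbn in *.
  induction (equiv_map El_nat u) as [|m IH]; [exact H0|exact (HS _ IH)].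
Qed.

Lemma interp_function {k : nat} (e : Fin.t k -> V T) (t : term T k) :
  is_function (eval e t) -> interp (f_function t) e.
Proof.
intros [R S]; split.
- intro u; destruct (R _ (memV_tilde _ u)) as [x [y E]]; exists x, y.
  apply interp_opair; exact E.
- intros x y y' [H H']; apply interp_opair_in in H, H'.
  rewrite !eval_shift in H; rewrite !eval_shift in H'; exact (S _ _ _ H H').
Qed.

Lemma interp_domain {k : nat} (e : Fin.t k -> V T) (t d : term T k) :
  has_domain (eval e t) (eval e d) -> interp (f_domain t d) e.
Proof.
intros D x; destruct (D x) as [H K]; split; cbn [interp]; rewrite eval_shift.
- intro Hx; destruct (H Hx) as [y Hy]; exists y.
  apply interp_opair_in; rewrite !eval_shift; exact Hy.
- intros [y Hy]; apply interp_opair_in in Hy; rewrite !eval_shift in Hy.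
  apply K; exists y; exact Hy.
Qed.

(** * Validity of the scheme *)

Lemma valid_DC {k : nat} (θ : formula T (1 + k)) (φ : formula T (2 + k)) :
  valid (DC θ φ).
Proof.
apply interp_valid; intros e step α Hα.
pose (B x := interp θ (fcons x e)).
pose (F x y := interp φ (fcons y (fcons x e))).
assert (Efcons : forall n (c c' : Fin.t n -> V T) x y, eqV x y ->
  (forall j, eqV (c j) (c' j)) -> forall j, eqV (fcons x c j) (fcons y c' j)).
{ intros n c c' x y E Ec j; apply (Fin.caseS' j); [exact E|exact Ec]. }
(* For the concrete depths 1, 2 and 7 the extended environment at [Fin.R l j] computes to [e j], so
   this serves as the hypothesis on parameters every time. *)
assert (Ee : forall j, eqV (e j) (e j)) by (intro; apply eqV_refl).
destruct (dependent_choice B F) with (α := α)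
  as [δ [[[Hfun Hdom] H0] HF]].
- intros x y [E H]; revert H; apply interp_eqV; auto.
- intros z x y [E H]; revert H; apply interp_eqV; auto using eqV_refl.
- intros z x y [E H]; revert H; apply interp_eqV; auto using eqV_refl.
- intros x Hx; destruct (step x) as [y [Hy Hxy]].
  + apply (snd (interp_inst1 θ i0 e (fcons x e) Ee)); exact Hx.
  + exists y; split.
    * exact (fst (interp_inst1 (l := 2) θ i0 e (fcons y (fcons x e)) Ee) Hy).
    * exact (fst (interp_inst2 (l := 2) φ i1 i0 e (fcons y (fcons x e)) Ee) Hxy).
- exact (fst (interp_inst1 (l := 1) θ i0 e (fcons α e) Ee) Hα).
- exists δ, (omegaV T); split; [|split; [|split; [|split]]].
  + apply interp_omega; reflexivity.
  + apply interp_function; exact Hfun.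
  + apply interp_domain; exact Hdom.
  + exists (emptyV T); split.
    * apply interp_empty; apply eqV_refl.
    * apply interp_opair_in; exact H0.
  + intros m m' β γ [Hs [Hβ Hγ]].
    apply interp_succ in Hs; apply interp_opair_in in Hβ, Hγ; cbn in Hs, Hβ, Hγ.
    destruct (HF _ (memV_tilde (omegaV T) m) β γ) as [HB HFβγ].
    { split; [exact Hβ|].
      (* [m'] is only [≐] to the successor of the element at [m]; the membership of its pair is
         moved along that equality. *)
      refine (memV_eqV_l _ _ _ _ Hγ).
      apply opairV_eqV; [exact Hs|reflexivity]. }
    split.
    * apply (snd (interp_inst1 (l := 7) θ i1 e _ Ee)); exact HB.
    * apply (snd (interp_inst2 (l := 7) φ i1 i0 e _ Ee)); exact HFβγ.
Qed.

End Iterative_sets.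

Theorem theorem6p12 (T : weak_tarski) (funext : FunExt) (ua : univalent T) :
  (forall (k : nat) (θ : formula T (1 + k)) (φ : formula T (2 + k)),
     valid (DC θ φ)) *
  (forall (B : V T -> Type) (F : V T -> V T -> Type),
     extensional B ->
     (forall y : V T, extensional (fun x => F x y)) ->
     (forall x : V T, extensional (fun y => F x y)) ->
     (forall x : V T, B x -> {y : V T & (B y * F x y)%type}) ->
     forall α : V T, B α ->
     {δ : V T &
       (is_function δ *
        has_domain δ (omegaV T) *
        memV (opairV (emptyV T) α) δ *
        (forall x : V T, memV x (omegaV T) ->
         forall β γ : V T,
           memV (opairV x β) δ * memV (opairV (succV x) γ) δ ->
           B β * F β γ))%type}).
Proof.
split; [exact (@valid_DC T)|exact dependent_choice].
Qed.
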